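(* Let $G$ be a distance-regular graph of diameter $3$ with intersection numbers $b_i,c_i,a_i$ and distinct adjacency eigenvalues $\theta_0>\theta_1>\theta_2>\theta_3$. Then \[ c_2(G)^2=\max\left\{4\frac{1-w_1(\theta_1)}{1-w_2(\theta_1)},\,9\frac{1-w_1(\theta_1)}{1-w_3(\theta_1)}\right\}=\max\left\{\frac{4b_1}{\theta_0+\theta_1-a_1},\ \frac{9b_1b_2}{(\theta_0+\theta_1-a_1)(\theta_0+\theta_1-a_2)-\theta_0\theta_1-b_1c_2-\theta_0}\right\}. \] Further, if $G$ is an antipodal $r$-cover, then \[ c_2(G)^2=9\frac{1-w_1(\theta_1)}{1-w_3(\theta_1)}=\frac{9b_1b_2}{(\theta_0+\theta_1-a_1)(\theta_0+\theta_1-a_2)-\theta_0\theta_1-b_1c_2-\theta_0}. \]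
   Context: A connected graph $G$ of diameter $d$ is distance-regular if it is $k$-regular and there are numbers $b_i,c_i$ such that for any two vertices $x,y$ at distance $i$, exactly $c_i$ neighbours of $y$ are at distance $i-1$ from $x$ and exactly $b_i$ are at distance $i+1$ from $x$; set $a_i=k-b_i-c_i$ (so $\theta_0=k$). For an eigenvalue $\theta$, the cosine sequence is defined by $w_0(\theta)=1$, $w_1(\theta)=\theta/k$, $c_iw_{i-1}(\theta)+a_iw_i(\theta)+b_iw_{i+1}(\theta)=\theta w_i(\theta)$ ($1\le i\le d-1$). $G$ is an antipodal $r$-cover if its distance-$d$ graph is a disjoint union of cliques of size $r\ge2$. For an injective map $\rho$ of the vertex set (with shortest-path metric $\delta$) into $\mathbb{R}^n$, expansion$(\rho)=\max_{x\ne y}\|\rho(x)-\rho(y)\|/\delta(x,y)$, contraction$(\rho)=\max_{x\ne y}\delta(x,y)/\|\rho(x)-\rho(y)\|$, distortion = expansion$\cdot$contraction; $c_2(G)$ is the least distortion of such an embedding into Euclidean space. *)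

(* Defs.v *)
From HB Require Import structures.
From mathcomp Require Import all_boot all_order all_algebra.
From mathcomp Require Import classical_sets reals.

Set Implicit Arguments.
Unset Strict Implicit.
Unset Printing Implicit Defensive.

Import Order.TTheory GRing.Theory Num.Theory.

Local Open Scope ring_scope.

Section Graph.
Variables (V : finType) (e : rel V).

Definition simple_graph : Prop := symmetric e /\ irreflexive e.

Definition connected_graph : Prop := forall x y : V, connect e x y.

Definition walk_of_length (n : nat) (x y : V) : bool :=
  [exists p : n.-tuple V, path e x p && (last x p == y)].

(* A shortest path has fewer than #|V| edges; the value is #|V| (junk) when y
   cannot be reached from x. *)
Definition gdist (x y : V) : nat :=
  find (fun n => walk_of_length n x y) (iota 0 #|V|).

Definition diameter : nat := (\max_(x : V) \max_(y : V) gdist x y)%N.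

(* Here c 0 = 0 and b d = 0 necessarily, and b 0 = k. *)
Definition distance_regular (d k : nat) (b c : nat -> nat) : Prop :=
  [/\ simple_graph, connected_graph, diameter = d,
      forall x : V, #|[set y | e x y]| = k
    & forall (i : nat) (x y : V), gdist x y = i ->
        #|[set z | e y z & (gdist x z).+1 == i]| = c i /\
        #|[set z | e y z & gdist x z == i.+1]| = b i].

(* The distance-d graph (d the diameter) is a disjoint union of r-cliques, whose
   vertex sets are the blocks of P. *)
Definition antipodal_cover (r : nat) : Prop :=
  (2 <= r)%N /\
  exists P : {set {set V}},
    [/\ finset.partition P [set: V],
        forall B : {set V}, B \in P -> #|B| = r
      & forall x y : V,
          (gdist x y == diameter) = (x != y) && (finset.pblock P x == finset.pblock P y)].

End Graph.

Section Spectrum.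
Variables (R : realType) (V : finType) (e : rel V).

Definition adjacency_mx : 'M[R]_#|V| :=
  \matrix_(i, j) (e (enum_val i) (enum_val j))%:R.

Definition a_ (k : nat) (b c : nat -> nat) (i : nat) : R :=
  k%:R - (b i)%:R - (c i)%:R.

Definition cosine_sequence (d k : nat) (b c : nat -> nat) (theta : R)
    (w : nat -> R) : Prop :=
  [/\ w 0%N = 1, w 1%N = theta / k%:R
    & forall i : nat, (1 <= i <= d.-1)%N ->
        (c i)%:R * w i.-1 + a_ k b c i * w i + (b i)%:R * w i.+1
          = theta * w i].

End Spectrum.

Section Distortion.
Variables (R : realType) (V : finType) (e : rel V).

(* The library norm on 'rV[R]_n is the sup norm, hence this definition. *)
Definition l2norm (n : nat) (u : 'rV[R]_n) : R :=
  Num.sqrt (\sum_(i < n) u 0 i ^+ 2).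

(* All the terms are nonnegative, so the base value 0 does not affect the max. *)
Definition expansion (n : nat) (rho : V -> 'rV[R]_n) : R :=
  \big[Num.max/0]_(p : V * V | p.1 != p.2)
    (l2norm (rho p.1 - rho p.2) / (gdist e p.1 p.2)%:R).

Definition contraction (n : nat) (rho : V -> 'rV[R]_n) : R :=
  \big[Num.max/0]_(p : V * V | p.1 != p.2)
    ((gdist e p.1 p.2)%:R / l2norm (rho p.1 - rho p.2)).

Definition distortion (n : nat) (rho : V -> 'rV[R]_n) : R :=
  expansion rho * contraction rho.

Definition euclidean_distortions : set R :=
  [set D | exists (n : nat) (rho : V -> 'rV[R]_n),
             injective rho /\ distortion rho = D]%classic.

(* C is c_2(G): the distortion C is attained, and it is the least one. *)
Definition is_c2 (C : R) : Prop :=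
  euclidean_distortions C /\ lbound euclidean_distortions C.

End Distortion.

(* Main.v *)
(* A map f : V -> R splits into spectral parts q_t(f) >= 0, one for each eigenvalue
   t, and the sum of (f x - f y)^2 over the pairs at distance j is
   2 k_j sum_t (1 - w_j(t)) q_t(f).  The ratio (1 - w_j(t)) / (1 - w_1(t)) is
   increasing in t for j = 2 and a convex quadratic in t for j = 3; in the latter
   case its values at theta1 and theta3 differ by a positive multiple of
   a_3 - theta2, which is nonnegative.  So theta1 always maximizes it, which bounds
   the mean squared distance over the pairs at distance j in terms of the one over
   the edges, for every Euclidean embedding, and hence bounds the distortion from
   below.  The embedding into the theta1-eigenspace meets the bound.  In an
   antipodal cover w_2 = w_1 w_3 and theta1 >= 0, so that the term j = 3 is the
   larger one. *)

Require Import Defs.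
From HB Require Import structures.
From mathcomp Require Import all_boot all_order all_algebra.
From mathcomp Require Import classical_sets reals.
From mathcomp Require Import ring lra.

Set Implicit Arguments.
Unset Strict Implicit.
Unset Printing Implicit Defensive.

Import Order.TTheory GRing.Theory Num.Theory.

Local Open Scope ring_scope.

(** * Graph distance *)

Section GraphDistance.
Variables (V : finType) (e : rel V).
Hypotheses (e_simple : simple_graph e) (e_conn : connected_graph e).

Lemma walkP n x y :
  reflect (exists p, [/\ size p = n, path e x p & last x p = y])
          (walk_of_length e n x y).
Proof.
apply: (iffP existsP) => [[p /andP[ep /eqP lp]]|[p [sp ep lp]]].
  by exists p; rewrite size_tuple.
have sp' : size p == n by apply/eqP.
by exists (Tuple sp'); rewrite /= ep lp eqxx.
Qed.

Lemma gdist_le_walk n x y : walk_of_length e n x y -> (gdist e x y <= n)%N.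
Proof.
move=> wn; rewrite /gdist leqNgt; apply/negP => n_lt.
have n_ltV : (n < #|V|)%N.
  by apply: leq_trans n_lt _; rewrite -[X in (_ <= X)%N](size_iota 0) find_size.
by have := before_find 0%N n_lt; rewrite nth_iota // add0n wn.
Qed.

(** A path shortened until no vertex repeats has fewer than [#|V|] edges, so [find] succeeds and its
    junk value never occurs. *)
Lemma gdist_walk x y : walk_of_length e (gdist e x y) x y.
Proof.
have /connectP[p ep ->] := e_conn x y.
case/shortenP: ep => p' ep' up' _.
have sp' : (size p' < #|V|)%N.
  by have /card_uniqP/= <- := up'; apply: max_card.
have w : walk_of_length e (size p') x (last x p') by apply/walkP; exists p'.
have hasw : has (fun n => walk_of_length e n x (last x p')) (iota 0 #|V|).
  by apply/hasP; exists (size p'); rewrite ?mem_iota.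
have := nth_find 0%N hasw; rewrite nth_iota ?add0n //.
by rewrite -[X in (_ < X)%N](size_iota 0) -has_find.
Qed.

Lemma walk_sym n x y : walk_of_length e n x y -> walk_of_length e n y x.
Proof.
have [e_sym _] := e_simple.
case/walkP=> p [sp ep <-]; apply/walkP; exists (rev (belast x p)).
rewrite size_rev size_belast rev_path (eq_path (e' := e)); last first.
  by move=> u v /=; rewrite e_sym.
by split=> //; case: p {sp ep} => //= z p; rewrite rev_cons last_rcons.
Qed.

Lemma gdistC x y : gdist e x y = gdist e y x.
Proof.
by apply/eqP; rewrite eqn_leq !gdist_le_walk // walk_sym // gdist_walk.
Qed.

Lemma gdist_eq0 x y : (gdist e x y == 0%N) = (x == y).
Proof.
apply/eqP/eqP => [d0|->].
  by have /walkP[p [sp _ <-]] := gdist_walk x y; move: sp; rewrite d0; case: p.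
by apply/eqP; rewrite -leqn0 gdist_le_walk //; apply/walkP; exists [::].
Qed.

Lemma gdistxx x : gdist e x x = 0%N.
Proof. by apply/eqP; rewrite gdist_eq0. Qed.

Lemma gdist_step x y z : e y z -> (gdist e x z <= (gdist e x y).+1)%N.
Proof.
move=> eyz; apply: gdist_le_walk; have /walkP[p [sp ep lp]] := gdist_walk x y.
by apply/walkP; exists (rcons p z); rewrite size_rcons sp rcons_path ep lp last_rcons.
Qed.

Lemma gdist_adj x y : (gdist e x y == 1%N) = e x y.
Proof.
apply/eqP/idP => [d1|exy].
  have /walkP[p [sp]] := gdist_walk x y; move: sp; rewrite d1.
  by case: p => [|z [|]] //= _ /andP[exz _] <-.
have [_ e_irr] := e_simple.
apply/eqP; rewrite eqn_leq (leq_trans (gdist_step x exy)) ?gdistxx //=.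
by rewrite lt0n gdist_eq0; apply: contraTneq exy => ->; rewrite e_irr.
Qed.

(** The witness is the penultimate vertex of a shortest walk; its distance cannot be below [i],
    since one edge raises the distance by at most one. *)
Lemma gdist_pred x y i : gdist e x y = i.+1 ->
  exists2 z, e y z & gdist e x z = i.
Proof.
have [e_sym _] := e_simple.
move=> d_xy; have /walkP[p [sp ep lp]] := gdist_walk x y.
move: sp ep lp; rewrite d_xy; case/lastP: p => // p z.
rewrite size_rcons rcons_path last_rcons => -[sp] /andP[ep ez] zy.
rewrite zy in ez; exists (last x p); first by rewrite e_sym.
apply/eqP; rewrite eqn_leq gdist_le_walk /=; last by apply/walkP; exists p.
by rewrite -ltnS -d_xy gdist_step.
Qed.

Lemma gdist_le_diameter x y : (gdist e x y <= diameter e)%N.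
Proof.
apply: (@leq_trans (\max_(z : V) gdist e x z)).
  exact: (leq_bigmax (F := fun z => gdist e x z)).
exact: (leq_bigmax (F := fun x => \max_(z : V) gdist e x z)).
Qed.

(** The successor matters: the maximum over an empty vertex set is 0 and is not attained. *)
Lemma diameter_attained d : diameter e = d.+1 ->
  exists x y, gdist e x y = d.+1.
Proof.
move=> diam; have [/existsP[x /existsP[y /eqP xy]]|no] :=
  boolP [exists x, exists y, gdist e x y == d.+1]; first by exists x, y.
suff : (d.+1 <= d)%N by rewrite ltnn.
rewrite -{1}diam; apply/bigmax_leqP => x _; apply/bigmax_leqP => y _.
rewrite -ltnS ltn_neqAle -{2}diam gdist_le_diameter andbT.
by apply: contra no => xy; apply/existsP; exists x; apply/existsP; exists y.
Qed.

End GraphDistance.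

(** * Intersection arrays of diameter 3 *)

(** Vieta's formula by divided differences: the third one, at the four distinct roots, is their sum
    plus [p]. *)
Lemma sum_roots_quartic (R : fieldType) (p q r s x0 x1 x2 x3 : R) :
  x0 != x1 -> x0 != x2 -> x0 != x3 -> x1 != x2 -> x1 != x3 -> x2 != x3 ->
  (forall x, x \in [:: x0; x1; x2; x3] ->
     x ^+ 4 + p * x ^+ 3 + q * x ^+ 2 + r * x + s = 0) ->
  x0 + x1 + x2 + x3 + p = 0.
Proof.
move=> n01 n02 n03 n12 n13 n23 root.
(* First divided difference: [(x - y) * D x y] is the difference of the values of the quartic at [x]
   and [y]. *)
pose D x y := x ^+ 3 + x ^+ 2 * y + x * y ^+ 2 + y ^+ 3 +
  p * (x ^+ 2 + x * y + y ^+ 2) + q * (x + y) + r.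
have D0 x y : x != y -> x \in [:: x0; x1; x2; x3] ->
    y \in [:: x0; x1; x2; x3] -> D x y = 0.
  rewrite -subr_eq0 => /mulfI xy /root Ex /root Ey.
  by apply: xy; rewrite mulr0 -[RHS](subrr 0) -{1}Ex -Ey /D; ring.
(* Second divided difference, at [x0], [x] and [y]. *)
pose T x y := x0 ^+ 2 + x ^+ 2 + y ^+ 2 + x0 * x + x0 * y + x * y +
  p * (x0 + x + y) + q.
have T0 x y : x0 != x -> x0 != y -> x != y -> x \in [:: x1; x2; x3] ->
    y \in [:: x1; x2; x3] -> T x y = 0.
  move=> n0x n0y; rewrite -subr_eq0 => /mulfI xy xin yin.
  have Ex : D x0 x = 0 by rewrite D0 ?mem_head // in_cons xin orbT.
  have Ey : D x0 y = 0 by rewrite D0 ?mem_head // in_cons yin orbT.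
  by apply: xy; rewrite mulr0 -[RHS](subrr 0) -{1}Ex -Ey /D /T; ring.
have T12 : T x1 x2 = 0 by rewrite T0 // !inE eqxx ?orbT.
have T13 : T x1 x3 = 0 by rewrite T0 // !inE eqxx ?orbT.
move: n23; rewrite -subr_eq0 => /mulfI; apply.
by rewrite mulr0 -[RHS](subrr 0) -{1}T12 -T13 /T; ring.
Qed.


Section IntersectionArray.
Variable (R : realFieldType) (k b1 b2 c2 c3 : R).
Hypotheses (k_gt0 : 0 < k) (b1_gt0 : 0 < b1) (b2_gt0 : 0 < b2).
Hypotheses (c2_gt0 : 0 < c2) (c3_gt0 : 0 < c3).

Let a1 := k - b1 - 1.
Let a2 := k - b2 - c2.
Let a3 := k - c3.

(* Junk value 0 for i >= 4, here and in sphere_size. *)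
Definition cos_seq (t : R) (i : nat) : R :=
  let w1 := t / k in
  let w2 := ((t - a1) * w1 - 1) / b1 in
  let w3 := ((t - a2) * w2 - c2 * w1) / b2 in
  nth 0 [:: 1; w1; w2; w3] i.
Arguments cos_seq : simpl never.
Local Notation w := cos_seq.

Definition sphere_size (i : nat) : R :=
  nth 0 [:: 1; k; k * b1 / c2; k * b1 * b2 / (c2 * c3)] i.
Arguments sphere_size : simpl never.
Local Notation K := sphere_size.

(* The last row of the three-term recurrence: it singles out the eigenvalues. *)
Definition cos_eigen (t : R) := c3 * w t 2 + a3 * w t 3 = t * w t 3.

Lemma cos_seq0 t : w t 0 = 1. Proof. by []. Qed.

Lemma cos_seq1 t : k * w t 1 = t.
Proof. by rewrite /w /= mulrC divfK // gt_eqF. Qed.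

Lemma cos_seq2 t : 1 + a1 * w t 1 + b1 * w t 2 = t * w t 1.
Proof. by rewrite /w /=; field; rewrite !gt_eqF. Qed.

Lemma cos_seq3 t : c2 * w t 1 + a2 * w t 2 + b2 * w t 3 = t * w t 2.
Proof. by rewrite /w /=; field; rewrite !gt_eqF. Qed.

Lemma sphere_size1 : K 1 * b1 = K 2 * c2.
Proof. by rewrite /K /=; field; rewrite gt_eqF. Qed.

Lemma sphere_size2 : K 2 * b2 = K 3 * c3.
Proof. by rewrite /K /=; field; rewrite !gt_eqF. Qed.

Lemma sphere_size_gt0 i : (i < 4)%N -> 0 < K i.
Proof.
by case: i => [|[|[|[|]]]] //= _; rewrite /K /= ?divr_gt0 ?mulr_gt0.
Qed.

(** For an eigenvalue [t] of a graph with this array, [cos_dot t t] is the number of vertices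
    divided by the multiplicity of [t]. *)
Definition cos_dot (t u : R) : R := \sum_(i < 4) K i * w t i * w u i.

Lemma cos_dotE t u : cos_dot t u =
  1 + K 1 * w t 1 * w u 1 + K 2 * w t 2 * w u 2 + K 3 * w t 3 * w u 3.
Proof.
rewrite /cos_dot !big_ord_recr big_ord0 /= add0r.
by rewrite -!/(w _ _) [K 0]/(1) [w t 0]/(1) [w u 0]/(1) !mulr1.
Qed.

Lemma cos_dot_gt0 t : 0 < cos_dot t t.
Proof.
have sq i : (i < 4)%N -> 0 <= K i * w t i * w t i.
  by move=> i4; rewrite -mulrA mulr_ge0 -?expr2 ?sqr_ge0 // ltW // sphere_size_gt0.
by rewrite cos_dotE !ltr_wpDr ?sq.
Qed.

(* The tridiagonal intersection matrix is self-adjoint for the weights K i,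
   so that eigenvectors with distinct eigenvalues are orthogonal. *)
Lemma cos_dot_eq0 t u : cos_eigen t -> cos_eigen u -> t != u -> cos_dot t u = 0.
Proof.
move=> Et Eu; rewrite -subr_eq0 => /mulfI; apply; rewrite mulr0 cos_dotE.
have -> : (t - u) * (1 + K 1 * w t 1 * w u 1 + K 2 * w t 2 * w u 2 +
    K 3 * w t 3 * w u 3) = (t - u) +
  K 1 * ((t * w t 1) * w u 1 - w t 1 * (u * w u 1)) +
  K 2 * ((t * w t 2) * w u 2 - w t 2 * (u * w u 2)) +
  K 3 * ((t * w t 3) * w u 3 - w t 3 * (u * w u 3)) by ring.
rewrite -Et -Eu -!cos_seq2 -!cos_seq3 -{1}(cos_seq1 t) -{1}(cos_seq1 u).
have -> : k = K 1 by [].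
transitivity ((w t 2 * w u 1 - w t 1 * w u 2) * (K 1 * b1 - K 2 * c2) +
  (w t 3 * w u 2 - w t 2 * w u 3) * (K 2 * b2 - K 3 * c3)); first by ring.
by rewrite sphere_size1 sphere_size2 !subrr !mulr0 addr0.
Qed.

Lemma cos_seqk i : (i < 4)%N -> w k i = 1.
Proof.
by case: i => [|[|[|[|]]]] // _; rewrite /w /= /a1 /a2; field; rewrite !gt_eqF.
Qed.

Lemma cos_eigenk : cos_eigen k.
Proof. by rewrite /cos_eigen !cos_seqk // /a3; ring. Qed.

(** Compares the ratios [(1 - w t 2) / (1 - w t 1)] at [u] and [t]. The cross-multiplied form, here
    and in [cos_ratio3], also covers [k], where the ratio is 0/0. *)
Lemma cos_ratio2 t u : (1 - w u 2) * (1 - w t 1) - (1 - w t 2) * (1 - w u 1) =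
  (k - t) * (k - u) * (u - t) / (k ^+ 2 * b1).
Proof. by rewrite /w /= /a1; field; rewrite !gt_eqF. Qed.

Lemma cos_ratio3 t u : (1 - w u 3) * (1 - w t 1) - (1 - w t 3) * (1 - w u 1) =
  (k - t) * (k - u) * (u - t) * (t + u + k - a1 - a2) / (k ^+ 2 * b1 * b2).
Proof. by rewrite /w /= /a1 /a2; field; rewrite !gt_eqF. Qed.

(** * Four eigenvalues in decreasing order *)

Variable th : 'I_4 -> R.
Hypotheses (th0 : th 0 = k) (th_eig : forall t, cos_eigen (th t)).
Hypotheses (th_decr : {homo th : s t / (s < t)%N >-> t < s}).

Lemma th_inj : injective th.
Proof.
move=> s t; case: (ltngtP s t) => [/th_decr|/th_decr|/val_inj //].
  by move=> + E; rewrite E ltxx.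
by move=> + E; rewrite E ltxx.
Qed.

Lemma cos_dot_delta s t :
  cos_dot (th s) (th t) = (s == t)%:R * cos_dot (th s) (th s).
Proof.
have [->|st] := eqVneq; first by rewrite mul1r.
by rewrite mul0r cos_dot_eq0 // (inj_eq th_inj).
Qed.

(** Orthogonality of the four cosine sequences says [P *m Q = 1]; for square matrices this gives
    [Q *m P = 1], which is the claim. *)
Lemma cos_dual_orthogonal (i j : 'I_4) :
  \sum_t w (th t) i / cos_dot (th t) (th t) * (K j * w (th t) j) = (i == j)%:R.
Proof.
pose P : 'M[R]_4 := \matrix_(s, j) (K j * w (th s) j).
pose Q : 'M[R]_4 := \matrix_(j, t) (w (th t) j / cos_dot (th t) (th t)).
have PQ : P *m Q = 1%:M.
  apply/matrixP => s t; rewrite !mxE.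
  under eq_bigr do rewrite !mxE mulrA.
  rewrite -mulr_suml -/(cos_dot _ _) cos_dot_delta.
  have [->|] := eqVneq; last by rewrite !mul0r.
  by rewrite mul1r divff // gt_eqF // cos_dot_gt0.
have /matrixP/(_ i j) := mulmx1C PQ; rewrite !mxE => <-.
by apply: eq_bigr => t _; rewrite !mxE.
Qed.

(** The column [j = 0] of the dual relation. In a graph it says that the spectral idempotents E_t,
    with entries [w (th t) i / cos_dot (th t) (th t)] at distance [i], sum to the identity. *)
Lemma cos_complete (i : 'I_4) :
  \sum_t w (th t) i / cos_dot (th t) (th t) = (i == 0)%:R.
Proof.
rewrite -(cos_dual_orthogonal i 0); apply: eq_bigr => t _.
by rewrite -[LHS]mulr1; congr (_ * _); rewrite /K /w /= mulr1.
Qed.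

(** The left side is the characteristic polynomial of the tridiagonal intersection matrix, expanded
    along its last row. *)
Lemma cos_eigen_quartic t : cos_eigen t ->
  (t - a3) * ((t - a2) * (t ^+ 2 - a1 * t - k) - b1 * c2 * t)
    - b2 * c3 * (t ^+ 2 - a1 * t - k) = 0.
Proof.
move=> /esym/eqP; rewrite -subr_eq0 => /eqP Et.
have -> : 0 = (t * w t 3 - (c3 * w t 2 + a3 * w t 3)) * (k * b1 * b2).
  by rewrite Et mul0r.
by rewrite /w /=; field; rewrite !gt_eqF.
Qed.

Let i1 := @Ordinal 4 1 isT.
Let i2 := @Ordinal 4 2 isT.
Let i3 := @Ordinal 4 3 isT.

(** The trace of the intersection matrix, whose first diagonal entry is 0. *)
Lemma sum_th : k + th i1 + th i2 + th i3 = a1 + a2 + a3.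
Proof.
apply/eqP; rewrite -subr_eq0; apply/eqP.
(* Lower coefficients of the characteristic polynomial; the cubic one, [- (a1 + a2 + a3)], is found
   by unification with the goal. *)
pose q := a1 * a2 - k - b1 * c2 + a3 * (a1 + a2) - b2 * c3.
pose r := a2 * k - a3 * (a1 * a2 - k - b1 * c2) + b2 * c3 * a1.
pose s := - a3 * a2 * k + b2 * c3 * k.
rewrite -th0; apply: (@sum_roots_quartic _ _ q r s);
  rewrite ?(inj_eq th_inj) // => x xin.
have Ex : cos_eigen x.
  by move: xin; rewrite !inE => /or4P[] /eqP-> //; apply: th_eig.
by rewrite -[RHS](cos_eigen_quartic Ex) /q /r /s; ring.
Qed.

Hypothesis a3_ge0 : 0 <= a3.

Lemma th_lt_k t : t != 0 -> th t < k.
Proof. by move=> t0; rewrite -th0 th_decr // lt0n. Qed.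

Lemma th_le1 t : t != 0 -> th t <= th i1.
Proof.
move=> t0; have [->//|t1] := eqVneq t i1; rewrite ltW // th_decr //.
by rewrite ltn_neqAle lt0n t0 andbT eq_sym.
Qed.

(* If th2 > a3 then the cosine sequences of both th1 and th2 would have the
   sign pattern (+,+,-,-), so they would not be orthogonal. *)
Lemma th2_le_a3 : th i2 <= a3.
Proof.
rewrite leNgt; apply/negP => a3_lt.
have th12 : th i2 < th i1 by apply: th_decr.
have P := sphere_size_gt0.
have signs t : a3 < t -> t < k -> cos_eigen t ->
    [/\ 0 <= w t 1, w t 2 <= 0 & w t 3 <= 0].
  move=> a3t tk Et.
  have w1 : 0 < w t 1 by rewrite /w /= divr_gt0 // (le_lt_trans a3_ge0).
  have E : (t - a3) * w t 3 = c3 * w t 2 by rewrite mulrBl -Et; ring.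
  (* Otherwise the last row makes [w t 3] positive too, and a positive sequence is not orthogonal to
     the constant cosine sequence of [k]. *)
  have w2 : w t 2 <= 0.
    rewrite leNgt; apply/negP => w2.
    have w3 : 0 < w t 3 by rewrite -(pmulr_rgt0 _ (x := t - a3)) ?subr_gt0 // E mulr_gt0.
    have := cos_dot_eq0 Et cos_eigenk (negbT (lt_eqF tk)).
    rewrite cos_dotE !cos_seqk // !mulr1 => D.
    suff : 0 < 1 + K 1 * w t 1 + K 2 * w t 2 + K 3 * w t 3 by rewrite D ltxx.
    by rewrite !addr_gt0 // mulr_gt0 // P.
  split; rewrite ?(ltW w1) //.
  by rewrite -(pmulr_rle0 _ (x := t - a3)) ?subr_gt0 // E pmulr_rle0.
have [u1 u2 u3] := signs _ a3_lt (th_lt_k (t := i2) isT) (th_eig _).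
have [v1 v2 v3] := signs _ (lt_trans a3_lt th12) (th_lt_k (t := i1) isT) (th_eig _).
have := cos_dot_eq0 (th_eig i2) (th_eig i1) (negbT (lt_eqF th12)).
suff : 0 < cos_dot (th i2) (th i1) by move=> + E; rewrite E ltxx.
have Kp i x : (i < 4)%N -> 0 <= x -> 0 <= K i * x.
  by move=> i4 x0; rewrite mulr_ge0 // ltW // P.
rewrite cos_dotE -!(mulrA (K _)) !ltr_wpDr //; apply: Kp => //.
all: by [exact: mulr_ge0 | exact: mulr_le0].
Qed.

Lemma cos_ratio2_le t :
  (1 - w (th t) 2) * (1 - w (th i1) 1) <= (1 - w (th i1) 2) * (1 - w (th t) 1).
Proof.
rewrite -subr_ge0 cos_ratio2.
have [->|t0] := eqVneq t 0; first by rewrite th0 subrr !mul0r.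
have t1 := th_le1 t0.
rewrite divr_ge0 ?mulr_ge0 ?subr_ge0 ?exprn_ge0 //.
all: by rewrite ltW // th_lt_k.
Qed.

(** The trace rewrites the last factor of [cos_ratio3] so that [th2_le_a3] decides its sign. *)
Lemma cos_ratio3_gap t : t + th i1 + k - a1 - a2 = t + a3 - th i2 - th i3.
Proof.
by apply/eqP; rewrite -subr_eq0; apply/eqP; move: sum_th; lra.
Qed.

(** The difference vanishes at [k] and [th i1]. At [th i2] and [th i3] the gap factor is
    [a3 - th i3] and [a3 - th i2], both nonnegative. *)
Lemma cos_ratio3_le t :
  (1 - w (th t) 3) * (1 - w (th i1) 1) <= (1 - w (th i1) 3) * (1 - w (th t) 1).
Proof.
have th23 : th i3 < th i2 by apply: th_decr.
have th12 : th i2 < th i1 by apply: th_decr.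
have th1k : th i1 < k by apply: th_lt_k.
have a3_ge := th2_le_a3.
rewrite -subr_ge0 cos_ratio3 cos_ratio3_gap.
have pos (x : R) : 0 <= x -> 0 <= x / (k ^+ 2 * b1 * b2).
  by move=> x0; rewrite divr_ge0 // !mulr_ge0 ?exprn_ge0 ?ltW.
have cases : [|| t == 0, t == i1, t == i2 | t == i3].
  by case: t => [[|[|[|[|]]]] ?].
apply: pos; case/or4P: cases => /eqP ->.
- by rewrite th0 subrr !mul0r.
- by rewrite subrr mulr0 mul0r.
- by rewrite !mulr_ge0 //; lra.
- by rewrite !mulr_ge0 //; lra.
Qed.

Hypothesis w_le1 : forall t i, (i < 4)%N -> w (th t) i <= 1.

Lemma cos1_lt1 : w (th i1) 1 < 1.
Proof. by rewrite /w /= ltr_pdivrMr // mul1r th_lt_k. Qed.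

(** By [cos_ratio2] the ratio at [th i1] strictly exceeds the one at [th i2], which is nonnegative.
    The same comparison gives [cos3_lt1]. *)
Lemma cos2_lt1 : w (th i1) 2 < 1.
Proof.
have th12 : th i2 < th i1 by apply: th_decr.
have th1k : th i1 < k by apply: th_lt_k.
have w21 : w (th i2) 1 < 1 by rewrite /w /= ltr_pdivrMr // mul1r th_lt_k.
have : 0 < (1 - w (th i1) 2) * (1 - w (th i2) 1) -
    (1 - w (th i2) 2) * (1 - w (th i1) 1).
  rewrite cos_ratio2 divr_gt0 ?mulr_gt0 ?exprn_gt0 ?subr_gt0 //.
  exact: lt_trans th1k.
have : 0 <= (1 - w (th i2) 2) * (1 - w (th i1) 1).
  by rewrite mulr_ge0 ?subr_ge0 ?w_le1.
move=> ge0 gt0; rewrite -subr_gt0 -(pmulr_lgt0 _ (x := 1 - w (th i2) 1)).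
  by move: ge0 gt0; lra.
by rewrite subr_gt0.
Qed.

Lemma cos3_lt1 : w (th i1) 3 < 1.
Proof.
have th23 : th i3 < th i2 by apply: th_decr.
have th12 : th i2 < th i1 by apply: th_decr.
have th1k : th i1 < k by apply: th_lt_k.
have a3_ge := th2_le_a3.
have w21 : w (th i2) 1 < 1 by rewrite /w /= ltr_pdivrMr // mul1r th_lt_k.
have : 0 < (1 - w (th i1) 3) * (1 - w (th i2) 1) -
    (1 - w (th i2) 3) * (1 - w (th i1) 1).
  rewrite cos_ratio3 cos_ratio3_gap divr_gt0 ?mulr_gt0 ?exprn_gt0 //; lra.
have : 0 <= (1 - w (th i2) 3) * (1 - w (th i1) 1).
  by rewrite mulr_ge0 ?subr_ge0 ?w_le1.
move=> ge0 gt0; rewrite -subr_gt0 -(pmulr_lgt0 _ (x := 1 - w (th i2) 1)).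
  by move: ge0 gt0; lra.
by rewrite subr_gt0.
Qed.

(* With A = sum_t th_t E_t, compare the entries of A and of I at distances 0
   and 3: the weights (w_0 - w_3) / N_t are nonnegative of sum 1, vanish for
   th_0 = k, and average th_t to 0. *)
Lemma th1_ge0 : 0 <= th i1.
Proof.
pose N t := cos_dot (th t) (th t).
pose g t := (1 - w (th t) 3) / N t.
have g_ge0 t : 0 <= g t.
  by rewrite divr_ge0 ?subr_ge0 ?w_le1 // ltW // cos_dot_gt0.
have g_sum : \sum_t g t = 1.
  transitivity (\sum_t w (th t) 0 / N t - \sum_t w (th t) i3 / N t).
    by rewrite -sumrB; apply: eq_bigr => t _; rewrite -mulrBl.
  by rewrite (cos_complete ord0) (cos_complete i3) /= subr0.
have g_avg : \sum_t th t * g t = 0.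
  have C1 : \sum_t w (th t) 1 / N t = 0 := cos_complete i1.
  have C2 : \sum_t w (th t) 2 / N t = 0 := cos_complete i2.
  have C3 : \sum_t w (th t) 3 / N t = 0 := cos_complete i3.
  (* Here [th t * (1 - w (th t) 3)] is expanded by [k * w (th t) 1 = th t] and the last row of the
     recurrence. *)
  transitivity (k * \sum_t w (th t) 1 / N t - c3 * (\sum_t w (th t) 2 / N t)
      - a3 * (\sum_t w (th t) 3 / N t)); last by rewrite C1 C2 C3 !mulr0 !subr0.
  rewrite !mulr_sumr -!sumrB; apply: eq_bigr => t _.
  rewrite /g (mulrA (th t)) mulrBr mulr1 -(th_eig t) -{1}(cos_seq1 (th t)); ring.
rewrite -g_avg -[leRHS]mulr1 -g_sum mulr_sumr; apply: ler_sum => t _.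
have [->|t0] := eqVneq t 0; last by rewrite ler_wpM2r // th_le1.
by rewrite /g th0 cos_seqk // subrr !mul0r !mulr0.
Qed.

End IntersectionArray.

(** * Euclidean distortion *)

Section EuclideanNorm.
Variables (R : realType) (n : nat).
Implicit Types u v : 'rV[R]_n.

Lemma sqr_l2norm u : l2norm u ^+ 2 = \sum_i u 0 i ^+ 2.
Proof. by rewrite sqr_sqrtr // sumr_ge0 // => i _; apply: sqr_ge0. Qed.

Lemma l2norm_ge0 u : 0 <= l2norm u. Proof. exact: sqrtr_ge0. Qed.

Lemma l2norm_gt0 u : u != 0 -> 0 < l2norm u.
Proof.
rewrite lt_def l2norm_ge0 andbT; apply: contra => /eqP u0.
apply/eqP/rowP => i; rewrite mxE; apply/eqP; rewrite -sqrf_eq0.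
have /eqP := sqr_l2norm u; rewrite u0 expr0n eq_sym psumr_eq0.
  by move=> /allP/(_ i)/(_ (mem_index_enum _)).
by move=> ? _; apply: sqr_ge0.
Qed.

End EuclideanNorm.

Section DistortionBounds.
Variables (R : realType) (V : finType) (e : rel V) (n : nat).
Variable rho : V -> 'rV[R]_n.
Hypotheses (e_conn : connected_graph e) (rho_inj : injective rho).

Lemma l2norm_le_expansion x y :
  l2norm (rho x - rho y) <= expansion e rho * (gdist e x y)%:R.
Proof.
have [<-|xy] := eqVneq x y.
  by rewrite subrr gdistxx // mulr0 /l2norm big1 ?sqrtr0 // => i _; rewrite mxE expr0n.
rewrite -ler_pdivrMr; last by rewrite ltr0n lt0n gdist_eq0.
exact: (le_bigmax_cond 0 (j := (x, y)) (P := fun p => p.1 != p.2)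
  (fun p => l2norm (rho p.1 - rho p.2) /
  (gdist e p.1 p.2)%:R)).
Qed.

Lemma gdist_le_contraction x y :
  (gdist e x y)%:R <= contraction e rho * l2norm (rho x - rho y).
Proof.
have [<-|xy] := eqVneq x y.
  rewrite gdistxx // mulr_ge0 ?l2norm_ge0 //; apply: bigmax_ge_id.
rewrite -ler_pdivrMr; last by rewrite l2norm_gt0 // subr_eq0 (inj_eq rho_inj).
exact: (le_bigmax_cond 0 (j := (x, y)) (P := fun p => p.1 != p.2)
  (fun p => (gdist e p.1 p.2)%:R /
  l2norm (rho p.1 - rho p.2))).
Qed.

Lemma distortion_ge0 : 0 <= distortion e rho.
Proof. by rewrite mulr_ge0 // bigmax_ge_id. Qed.

End DistortionBounds.

(** * Distance-regular graphs of diameter 3 *)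

Section Diameter3.
Variables (R : realType) (V : finType) (e : rel V) (k : nat) (b c : nat -> nat).
Hypothesis G_dr : distance_regular e 3 k b c.

Let e_simple : simple_graph e. Proof. by case: G_dr. Qed.
Let e_conn : connected_graph e. Proof. by case: G_dr. Qed.
Let diam3 : diameter e = 3%N. Proof. by case: G_dr. Qed.
Local Notation d := (gdist e).

(** * Intersection numbers and sums over neighbours *)

Lemma card_closer x y : #|[set z | e y z & (d x z).+1 == d x y]| = c (d x y).
Proof. by case: G_dr => _ _ _ _ /(_ _ x y erefl)[]. Qed.

Lemma card_farther x y : #|[set z | e y z & d x z == (d x y).+1]| = b (d x y).
Proof. by case: G_dr => _ _ _ _ /(_ _ x y erefl)[]. Qed.

Lemma card_nbrs x : #|[set y | e x y]| = k.
Proof. by case: G_dr. Qed.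

Lemma gdist_lt4 x y : (d x y < 4)%N.
Proof. by rewrite ltnS -diam3 gdist_le_diameter. Qed.

Lemma gdist_attained i : (i < 4)%N -> exists x y, d x y = i.
Proof.
have [x [y d3]] := diameter_attained diam3.
have [z _ d2] := gdist_pred e_simple e_conn d3.
have [t _ d1] := gdist_pred e_simple e_conn d2.
case: i => [|[|[|[|]]]] // _;
  [exists x, x | exists x, t | exists x, z | exists x, y] => //.
exact: gdistxx.
Qed.

Lemma c_gt0 i : (i < 3)%N -> (0 < c i.+1)%N.
Proof.
move=> i3; have [x [y d_xy]] := @gdist_attained i.+1 i3.
have [z ez d_xz] := gdist_pred e_simple e_conn d_xy.
rewrite -d_xy -card_closer; apply/card_gt0P; exists z.
by rewrite inE ez d_xz d_xy eqxx.
Qed.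

Lemma b_gt0 i : (i < 3)%N -> (0 < b i)%N.
Proof.
move=> i3; have [x [y d_xy]] := @gdist_attained i.+1 i3.
have [z ez d_xz] := gdist_pred e_simple e_conn d_xy.
rewrite -d_xz -card_farther; apply/card_gt0P; exists y.
by rewrite inE (proj1 e_simple) ez d_xz d_xy eqxx.
Qed.

Lemma intersection_c0 : c 0%N = 0%N.
Proof.
have [x _] := @gdist_attained 0 isT; have := card_closer x x.
rewrite gdistxx // => <-; apply: eq_card0 => z.
by rewrite !inE andbF.
Qed.

Lemma intersection_b3 : b 3%N = 0%N.
Proof.
have [x [y d_xy]] := @gdist_attained 3 isT; have := card_farther x y.
rewrite d_xy => <-.
apply: eq_card0 => z; rewrite !inE andbC.
by have := gdist_lt4 x z; case: eqP => // ->.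
Qed.

Lemma intersection_b0 : b 0%N = k.
Proof.
have [x _] := @gdist_attained 0 isT.
have := card_farther x x; rewrite gdistxx // => <-; rewrite -(card_nbrs x).
apply: eq_card => z; by rewrite !inE gdist_adj // andbb.
Qed.

Lemma intersection_c1 : c 1%N = 1%N.
Proof.
have [x [y d_xy]] := @gdist_attained 1 isT; have := card_closer x y.
rewrite d_xy => <-; rewrite -[RHS](cards1 x); apply: eq_card => z.
rewrite !inE eqSS (gdist_eq0 e_conn).
rewrite andbC eq_sym; case: eqP => //= ->.
by rewrite (proj1 e_simple) -gdist_adj // d_xy.
Qed.

Lemma nbr_sum (g : nat -> R) x y : \sum_(z | e y z) g (d x z) =
  (c (d x y))%:R * g (d x y).-1 + a_ R k b c (d x y) * g (d x y)
    + (b (d x y))%:R * g (d x y).+1.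
Proof.
set i := d x y.
have card_sum (P : pred V) (s : R) : \sum_(z | e y z) (P z)%:R * s =
    #|[set z | e y z & P z]|%:R * s.
  rewrite -mulr_suml; congr (_ * _); rewrite -sum1dep_card natr_sum.
  by rewrite [RHS]big_mkcondr; apply: eq_bigr => z _; case: (P z).
(* Every neighbour contributes [g i], corrected when it is closer or farther. For [i = 0] no
   neighbour is closer, so the value of [i.-1] is harmless. *)
transitivity (\sum_(z | e y z) (((d x z).+1 == i)%:R * (g i.-1 - g i) +
    (d x z == i.+1)%:R * (g i.+1 - g i) + (e y z)%:R * g i)).
  apply: eq_bigr => z eyz; rewrite eyz.
  have le1 := gdist_step e_conn x eyz.
  have le2 : (i <= (d x z).+1)%N.
    by apply: gdist_step => //; rewrite (proj1 e_simple).
  move: le1 le2; rewrite -/i; move: (d x z) => j.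
  rewrite leq_eqVlt => /orP[/eqP-> _|].
    by rewrite eqxx (gtn_eqF (leqnSn i.+1)) /=; ring.
  rewrite ltnS leq_eqVlt => /orP[/eqP-> _|ji ij].
    by rewrite (ltn_eqF (ltnSn i)) (gtn_eqF (ltnSn i)) /=; ring.
  have -> : i = j.+1 by apply/eqP; rewrite eqn_leq ij ji.
  by rewrite eqxx (ltn_eqF (leqnSn j.+1)) /=; ring.
rewrite !big_split /= !card_sum card_closer card_farther.
have -> : #|[set z | e y z & e y z]| = k.
  by rewrite -(card_nbrs y); apply: eq_card => z; rewrite !inE andbb.
rewrite /a_; ring.
Qed.

Lemma sum_by_gdist x (G : V -> R) :
  \sum_z G z = \sum_(i < 4) \sum_(z | d x z == i) G z.
Proof.
rewrite (partition_big (fun z => inord (d x z) : 'I_4) predT) //=.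
apply: eq_bigr => i _; apply: eq_bigl => z.
by rewrite -val_eqE /= inordK // gdist_lt4.
Qed.

Local Notation kR := (k%:R : R).
Local Notation B1 := ((b 1)%:R : R).
Local Notation B2 := ((b 2)%:R : R).
Local Notation C2 := ((c 2)%:R : R).
Local Notation C3 := ((c 3)%:R : R).
Local Notation w := (cos_seq kR B1 B2 C2).
Local Notation K := (sphere_size kR B1 B2 C2 C3).
Local Notation cos_eigen := (cos_eigen kR B1 B2 C2 C3).
Local Notation N t := (cos_dot kR B1 B2 C2 C3 t t).

Let k_gt0 : 0 < kR. Proof. by rewrite ltr0n -intersection_b0 b_gt0. Qed.
Let B1_gt0 : 0 < B1. Proof. by rewrite ltr0n b_gt0. Qed.
Let B2_gt0 : 0 < B2. Proof. by rewrite ltr0n b_gt0. Qed.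
Let C2_gt0 : 0 < C2. Proof. by rewrite ltr0n c_gt0. Qed.
Let C3_gt0 : 0 < C3. Proof. by rewrite ltr0n c_gt0. Qed.

(** * Eigenfunctions and their sums over spheres *)

Definition eigenfun (t : R) (h : V -> R) :=
  forall x, \sum_(y | e x y) h y = t * h x.

Section SphereSums.
Variables (t : R) (h : V -> R) (x : V).
Hypothesis h_eigen : eigenfun t h.

Let S i := \sum_(z | d x z == i) h z.

(** Self-adjointness of adjacency, with [h] paired against the radial function [g (d x z)]. Taking
    for [g] the indicator of one distance gives one linear relation among the [S i]. *)
Lemma sphere_sum_rec (g : nat -> R) :
  t * (g 0 * S 0 + g 1 * S 1 + g 2 * S 2 + g 3 * S 3) =
  S 0 * (kR * g 1) + S 1 * (g 0 + (kR - B1 - 1) * g 1 + B1 * g 2) +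
  S 2 * (C2 * g 1 + (kR - B2 - C2) * g 2 + B2 * g 3) +
  S 3 * (C3 * g 2 + (kR - C3) * g 3).
Proof.
transitivity (\sum_z g (d x z) * (t * h z)).
  rewrite (sum_by_gdist x) !big_ord_recr big_ord0 /= add0r /S.
  rewrite !mulrDr !mulr_sumr; congr (_ + _ + _ + _);
    by apply: eq_bigr => z /eqP->; ring.
transitivity (\sum_u h u * \sum_(z | e u z) g (d x z)).
  under eq_bigr => z _ do rewrite -h_eigen mulr_sumr big_mkcond.
  rewrite exchange_big; apply: eq_bigr => u _ /=.
  rewrite mulr_sumr [RHS]big_mkcond; apply: eq_bigr => z _.
  by rewrite (proj1 e_simple) mulrC.
rewrite (sum_by_gdist x) !big_ord_recr big_ord0 /= add0r /S.
rewrite !mulr_suml; congr (_ + _ + _ + _);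
  by apply: eq_bigr => z /eqP d_xz; rewrite nbr_sum d_xz /a_ /=
       ?intersection_c0 ?intersection_b0 ?intersection_c1 ?intersection_b3; ring.
Qed.

(** The indicators of the distances 0, 1 and 2 determine [S 1], [S 2] and [S 3] in turn. *)
Lemma sphere_sum i : (i < 4)%N -> S i = K i * w t i * h x.
Proof.
have S0 : S 0 = h x.
  rewrite /S (big_pred1 x) // => z; rewrite gdist_eq0 //=; exact: eq_sym.
have S1 : S 1 = t * h x.
  by have := sphere_sum_rec (fun i => (i == 0)%:R) => /= E; rewrite -S0; lra.
have S2 : S 2 = ((t - (kR - B1 - 1)) * t - kR) / C2 * h x.
  have := sphere_sum_rec (fun i => (i == 1)%:R) => /= E.
  apply: (mulfI (lt0r_neq0 C2_gt0)).
  transitivity (((t - (kR - B1 - 1)) * t - kR) * h x); last by field; rewrite gt_eqF.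
  by move: E; rewrite S0 S1; lra.
have S3 : S 3 = ((t - (kR - B2 - C2)) * (((t - (kR - B1 - 1)) * t - kR) / C2)
    - B1 * t) / C3 * h x.
  have := sphere_sum_rec (fun i => (i == 2)%:R) => /= E.
  apply: (mulfI (lt0r_neq0 C3_gt0)).
  transitivity ((t - (kR - B2 - C2)) * S 2 - B1 * S 1); first by lra.
  by rewrite S1 S2; field; rewrite !gt_eqF.
case: i => [|[|[|[|]]]] // _; rewrite ?S0 ?S1 ?S2 ?S3 /sphere_size /cos_seq /=.
all: by field; rewrite ?gt_eqF.
Qed.

(** The indicator of distance 3 supplies the one relation that [sphere_sum] leaves over. *)
Lemma eigenfun_cos_eigen : h x != 0 -> cos_eigen t.
Proof.
move=> hx0; have := sphere_sum_rec (fun i => (i == 3)%:R) => /=.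
rewrite !sphere_sum // => E.
have K3 : K 3 * h x != 0.
  by rewrite mulf_neq0 // gt_eqF // sphere_size_gt0.
apply: (mulfI K3); have := sphere_size2 kR B1 B2 C2_gt0 C3_gt0.
move=> E2.
transitivity ((K 3 * C3) * w t 2 * h x + K 3 * (kR - C3) * w t 3 * h x); first by ring.
by rewrite -E2; lra.
Qed.

End SphereSums.

Lemma cos_eigenfun t y : cos_eigen t -> eigenfun t (fun z => w t (d y z)).
Proof.
move=> Et x; rewrite nbr_sum /a_; have := gdist_lt4 y x.
have R1 := @cos_seq1 R kR B1 B2 C2 k_gt0 t.
have R2 := @cos_seq2 R kR B1 B2 C2 k_gt0 B1_gt0 t.
have R3 := @cos_seq3 R kR B1 B2 C2 k_gt0 B1_gt0 B2_gt0 t.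
case: (d y x) => [|[|[|[|]]]] // _ /=;
  rewrite ?intersection_c0 ?intersection_b0 ?intersection_c1 ?intersection_b3
    -?R2 -?R3 -?Et.
- by rewrite R1 cos_seq0; ring.
- by rewrite cos_seq0; ring.
- by ring.
Qed.

(** Idempotence of the matrix with entries [w t (d x y) / N t]: its columns are eigenfunctions, so
    [sphere_sum] evaluates the sum sphere by sphere around [x]. *)
Lemma cos_convolution t x y : cos_eigen t ->
  \sum_z w t (d x z) * w t (d y z) = N t * w t (d x y).
Proof.
move=> Et; have h_eig := cos_eigenfun y Et.
rewrite (sum_by_gdist x) /cos_dot mulr_suml; apply: eq_bigr => i _.
rewrite (gdistC e_simple e_conn x y).
transitivity (w t i * \sum_(z | d x z == i) w t (d y z)).
  by rewrite mulr_sumr; apply: eq_bigr => z /eqP->.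
by rewrite (sphere_sum x h_eig) //; ring.
Qed.


(** Expanding the square leaves three convolutions. The bound [cos_le1], the comparison [cos_le_sqr]
    and the lengths in the optimal embedding all come from here. *)
Lemma gdist_embedding x y t : cos_eigen t ->
  \sum_z (w t (d x z) - w t (d y z)) ^+ 2 = 2 * N t * (1 - w t (d x y)).
Proof.
move=> Et; transitivity (\sum_z w t (d x z) * w t (d x z) +
    \sum_z w t (d y z) * w t (d y z) - 2 * \sum_z w t (d x z) * w t (d y z)).
  rewrite mulr_sumr -big_split -sumrB /=; apply: eq_bigr => z _; ring.
by rewrite !cos_convolution // !(gdistxx e_conn) cos_seq0; ring.
Qed.

Lemma cos_le1 t i : cos_eigen t -> (i < 4)%N -> w t i <= 1.
Proof.
move=> Et /gdist_attained[x [y <-]]; rewrite -subr_ge0.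
have N_gt0 : 0 < 2 * N t by rewrite mulr_gt0 // cos_dot_gt0.
rewrite -(pmulr_rge0 _ N_gt0) -gdist_embedding //.
by apply: sumr_ge0 => z _; apply: sqr_ge0.
Qed.

Lemma cos_geN1 t i : cos_eigen t -> (i < 4)%N -> -1 <= w t i.
Proof.
move=> Et /gdist_attained[x [y <-]]; rewrite -subr_ge0 opprK.
have N_gt0 : 0 < 2 * N t by rewrite mulr_gt0 // cos_dot_gt0.
rewrite -(pmulr_rge0 _ N_gt0).
have -> : 2 * N t * (w t (d x y) + 1) = \sum_z (w t (d x z) + w t (d y z)) ^+ 2.
  transitivity (\sum_z w t (d x z) * w t (d x z) +
      \sum_z w t (d y z) * w t (d y z) + 2 * \sum_z w t (d x z) * w t (d y z)).
    by rewrite !cos_convolution // !(gdistxx e_conn) cos_seq0; ring.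
  rewrite mulr_sumr -!big_split /=; apply: eq_bigr => z _; ring.
by apply: sumr_ge0 => z _; apply: sqr_ge0.
Qed.

(** The case of [sphere_sum] for the constant function 1, an eigenfunction for [k]. *)
Lemma card_sphere x i : (i < 4)%N -> (#|[set z | d x z == i]|)%:R = K i.
Proof.
move=> i4; have one_eig : eigenfun kR (fun=> 1).
  by move=> y; rewrite sumr_const -(card_nbrs y) mulr1 cardsE.
have := sphere_sum x one_eig i4; rewrite cos_seqk // !mulr1 => <-.
by rewrite sumr_const cardsE.
Qed.

(** * Spectral parts, sphere energies and adjacency eigenvalues *)

Definition spectral_part (t : R) (f : V -> R) : R :=
  (\sum_x \sum_y w t (d x y) * (f x * f y)) / N t.

(** As E_t is a symmetric idempotent, the quadratic form of E_t at [f] is the squared norm of the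
    projection E_t f. *)
Lemma spectral_part_ge0 t f : cos_eigen t -> 0 <= spectral_part t f.
Proof.
move=> Et; have N_gt0 : 0 < N t by rewrite cos_dot_gt0.
have -> : spectral_part t f =
    (\sum_z (\sum_x w t (d x z) * f x) ^+ 2) / N t ^+ 2.
  rewrite expr2 invfM mulrA; congr (_ / _); apply: (mulIf (lt0r_neq0 N_gt0)).
  rewrite divfK ?gt_eqF // mulr_suml.
  transitivity (\sum_x \sum_y \sum_z
      (w t (d x z) * w t (d y z)) * (f x * f y)).
    apply: eq_bigr => x _; rewrite mulr_suml; apply: eq_bigr => y _.
    by rewrite -mulr_suml cos_convolution //; ring.
  under eq_bigr do rewrite exchange_big /=.
  rewrite exchange_big /=; apply: eq_bigr => z _.
  rewrite expr2 big_distrlr /=; apply: eq_bigr => x _; apply: eq_bigr => y _.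
  by ring.
rewrite divr_ge0 ?exprn_ge0 ?(ltW N_gt0) //.
by apply: sumr_ge0 => z _; apply: sqr_ge0.
Qed.

Definition sphere_energy (j : nat) (f : V -> R) : R :=
  \sum_x \sum_(y | d x y == j) (f x - f y) ^+ 2.


Lemma eigenvalue_cos_eigen t : eigenvalue (adjacency_mx R e) t -> cos_eigen t.
Proof.
case/eigenvalueP=> v v_eig v_neq0.
have h_eig : eigenfun t (fun x => v 0 (enum_rank x)).
  move=> x; move/rowP/(_ (enum_rank x)): v_eig; rewrite !mxE => <-.
  rewrite [RHS](reindex (@enum_rank V)) /=; last exact/onW_bij/enum_rank_bij.
  rewrite big_mkcond; apply: eq_bigr => y _.
  rewrite mxE !enum_rankK (proj1 e_simple).
  by case: (e y x); rewrite (mulr1, mulr0).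
have [i vi] : exists i, v 0 i != 0.
  apply/existsP; apply: contraNT v_neq0 => /existsPn v0.
  by apply/eqP/rowP => i; rewrite mxE; apply/eqP; rewrite -[_ == _]negbK v0.
apply: (eigenfun_cos_eigen (x := enum_val i) h_eig).
by rewrite enum_valK.
Qed.

Lemma eigenvalue_valency : eigenvalue (adjacency_mx R e) kR.
Proof.
apply/eigenvalueP; exists (const_mx 1).
  apply/rowP => j; rewrite !mxE mulr1 -(card_nbrs (enum_val j)).
  rewrite -sum1dep_card natr_sum [RHS]big_mkcond.
  rewrite [RHS](reindex (@enum_val V predT)) /=; last exact/onW_bij/enum_val_bij.
  apply: eq_bigr => i _; rewrite !mxE mul1r (proj1 e_simple).
  by case: (e _ _).
have [x _] := @gdist_attained 0 isT.
apply/eqP => /rowP/(_ (enum_rank x)); rewrite !mxE; apply/eqP; exact: oner_neq0.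
Qed.

Lemma eigenvalue_le_valency t : cos_eigen t -> t <= kR.
Proof.
move=> /cos_le1/(_ (isT : 1 < 4)%N).
by rewrite -(ler_pM2l k_gt0) mulr1 cos_seq1.
Qed.

Section Spectrum.
Variable th : 'I_4 -> R.
Hypotheses (th0 : th 0 = kR) (th_eig : forall t, cos_eigen (th t)).
Hypotheses (th_decr : {homo th : s t / (s < t)%N >-> t < s}).

(** The energy is twice the quadratic form of [K j] times the identity minus the distance-[j]
    matrix, and both matrices are combinations of the E_t. *)
Lemma sphere_energyE (j : nat) f : (j < 4)%N -> sphere_energy j f =
  2 * K j * \sum_t (1 - w (th t) j) * spectral_part (th t) f.
Proof.
move=> j4; pose F := \sum_x f x ^+ 2.
pose Q := \sum_x \sum_(y | d x y == j) f x * f y.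
(* The entry of that matrix at distance [i], expanded in the idempotents. *)
have dual i : (i < 4)%N ->
    \sum_t (1 - w (th t) j) * (w (th t) i / N (th t)) * K j =
    (i == 0)%:R * K j - (i == j)%:R.
  move=> i4; have C0 := cos_complete k_gt0 B1_gt0 B2_gt0 C2_gt0 C3_gt0
    th_eig th_decr (Ordinal i4).
  have Cj := cos_dual_orthogonal k_gt0 B1_gt0 B2_gt0 C2_gt0 C3_gt0
    th_eig th_decr (Ordinal i4) (Ordinal j4).
  rewrite -[(i == 0)%:R]C0 -[(i == j)%:R]Cj mulr_suml -sumrB.
  by apply: eq_bigr => t _ /=; ring.
transitivity (2 * (K j * F - Q)).
  have E1 : \sum_x \sum_(y | d x y == j) f x ^+ 2 = K j * F.
    rewrite mulr_sumr; apply: eq_bigr => x _.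
    by rewrite sumr_const -(card_sphere x j4) cardsE mulr_natl.
  have E2 : \sum_x \sum_(y | d x y == j) f y ^+ 2 = K j * F.
    rewrite -E1 (exchange_big_dep predT) //=; apply: eq_bigr => x _.
    by apply: eq_bigl => y; rewrite (gdistC e_simple e_conn).
  transitivity (K j * F + K j * F - 2 * Q); last by ring.
  rewrite -{1}E1 -E2 /Q mulr_sumr -big_split -sumrB /=; apply: eq_bigr => x _.
  by rewrite mulr_sumr -big_split -sumrB /=; apply: eq_bigr => y _; ring.
rewrite -mulrA; congr (2 * _); rewrite [RHS]mulr_sumr.
transitivity (\sum_x \sum_y
    (((d x y) == 0)%:R * K j - ((d x y) == j)%:R) * (f x * f y)).
  rewrite /F /Q mulr_sumr -sumrB; apply: eq_bigr => x _.
  transitivity (\sum_y ((x == y)%:R * K j * (f x * f y)) -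
     \sum_y ((d x y) == j)%:R * (f x * f y)).
    congr (_ - _).
      rewrite (bigD1 x) //= eqxx big1 ?addr0; first by rewrite mul1r expr2.
      by move=> y; rewrite eq_sym => /negPf->; rewrite !mul0r.
    by rewrite big_mkcond; apply: eq_bigr => y _; case: eqP; rewrite (mul1r, mul0r).
  rewrite -sumrB; apply: eq_bigr => y _.
  by rewrite mulrBl (gdist_eq0 e_conn).
transitivity (\sum_x \sum_y \sum_t
    (1 - w (th t) j) * (w (th t) (d x y) / N (th t)) * K j * (f x * f y)).
  apply: eq_bigr => x _; apply: eq_bigr => y _.
  by rewrite -dual ?gdist_lt4 // mulr_suml.
under eq_bigr do rewrite exchange_big /=.
rewrite exchange_big /=; apply: eq_bigr => t _.
rewrite /spectral_part mulr_suml !mulr_sumr; apply: eq_bigr => x _.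
by rewrite mulr_suml !mulr_sumr; apply: eq_bigr => y _; ring.
Qed.

(** * Distortion bound, optimal embedding and antipodal covers *)

Let i1 := @Ordinal 4 1 isT.
Local Notation W := (w (th i1)).

Lemma intersection_a3_ge0 : 0 <= kR - C3.
Proof.
have [x [y d_xy]] := @gdist_attained 3 isT; have := card_closer x y.
rewrite d_xy => <-; rewrite subr_ge0 ler_nat -(card_nbrs y).
by apply: subset_leq_card; apply/fintype.subsetP => z; rewrite !inE => /andP[].
Qed.

Let cos_th_le1 t i : (i < 4)%N -> w (th t) i <= 1.
Proof. exact: cos_le1. Qed.

Lemma cos_th1_lt1 i : (i < 3)%N -> W i.+1 < 1.
Proof.
case: i => [|[|[|]]] // _.
- exact: cos1_lt1.
- exact: cos2_lt1.
- exact: (cos3_lt1 k_gt0 B1_gt0 B2_gt0 C2_gt0 C3_gt0 th0 th_eig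
    th_decr intersection_a3_ge0).
Qed.

(** The inequality holds term by term in the spectral expansion: the parts are nonnegative and
    [th i1] maximizes the ratio. *)
Lemma sphere_energy_le f j : (j < 3)%N ->
  (1 - W 1) * sphere_energy j.+1 f / K j.+1 <=
  (1 - W j.+1) * sphere_energy 1 f / K 1.
Proof.
move=> j3; rewrite !sphere_energyE //.
have Kp i : (i < 4)%N -> K i != 0 by move=> i4; rewrite gt_eqF // sphere_size_gt0.
set S1 := \sum_t _; set S2 := \sum_t _.
suff : (1 - W 1) * S1 <= (1 - W j.+1) * S2.
  have -> : (1 - W 1) * (2 * K j.+1 * S1) / K j.+1 = 2 * ((1 - W 1) * S1).
    by move: (K j.+1) (Kp j.+1 j3) => x x0; field.
  have -> : (1 - W j.+1) * (2 * K 1 * S2) / K 1 = 2 * ((1 - W j.+1) * S2).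
    by move: (K 1) (Kp 1 isT) => x x0; field.
  by rewrite ler_pM2l.
rewrite {}/S1 {}/S2 !mulr_sumr; apply: ler_sum => t _.
rewrite (mulrA (1 - W 1)) (mulrA (1 - W j.+1)).
apply: ler_wpM2r; first exact: spectral_part_ge0.
rewrite [leLHS]mulrC; case: j j3 => [|[|[|]]] // _.
- by rewrite [leLHS]mulrC.
- exact: (@cos_ratio2_le R kR B1 B2 C2 k_gt0 B1_gt0 th th0 th_decr).
- exact: (cos_ratio3_le k_gt0 B1_gt0 B2_gt0 C2_gt0 C3_gt0 th0 th_eig
    th_decr intersection_a3_ge0).
Qed.

(** In the eigenspace embedding all edges have the same length, so a geodesic with [i] edges spans
    at most [i] times that length. *)
Lemma cos_le_sqr i : (i < 4)%N -> 1 - W i <= i%:R ^+ 2 * (1 - W 1).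
Proof.
have N_gt0 : 0 < 2 * N (th i1) by rewrite mulr_gt0 // cos_dot_gt0.
have step x y : e x y ->
    \sum_z (W (d x z) - W (d y z)) ^+ 2 = 2 * N (th i1) * (1 - W 1).
  by rewrite -gdist_adj // => /eqP d_xy; rewrite gdist_embedding // d_xy.
case: i => [|[|[|[|]]]] // _.
- by rewrite cos_seq0 subrr expr0n mul0r.
- by rewrite expr1n mul1r.
- have [x [y d2]] := @gdist_attained 2 isT.
  have [z ezy d1] := gdist_pred e_simple e_conn d2.
  have exz : e x z by rewrite -gdist_adj // d1.
  have E := gdist_embedding x y (th_eig i1).
  rewrite -(ler_pM2l N_gt0); rewrite d2 in E; rewrite -E {E}.
  have -> : 2 * N (th i1) * (2 ^+ 2 * (1 - W 1)) =
      2 * (\sum_u (W (d x u) - W (d z u)) ^+ 2 +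
           \sum_u (W (d y u) - W (d z u)) ^+ 2).
    by rewrite !step //; ring.
  rewrite -big_split mulr_sumr; apply: ler_sum => u _ /=.
  by have := sqr_ge0 (W (d x u) + W (d y u) - 2 * W (d z u)); lra.
have [x [y d3]] := @gdist_attained 3 isT.
have [z ezy d2] := gdist_pred e_simple e_conn d3.
have [t ezt d1] := gdist_pred e_simple e_conn d2.
have ext : e x t by rewrite -gdist_adj // d1.
have E := gdist_embedding x y (th_eig i1).
rewrite -(ler_pM2l N_gt0); rewrite d3 in E; rewrite -E {E}.
have -> : 2 * N (th i1) * (3 ^+ 2 * (1 - W 1)) =
    3 * (\sum_u (W (d x u) - W (d t u)) ^+ 2 +
         \sum_u (W (d z u) - W (d t u)) ^+ 2 +
         \sum_u (W (d y u) - W (d z u)) ^+ 2).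
  by rewrite !step //; ring.
rewrite -!big_split mulr_sumr; apply: ler_sum => u _ /=.
set p := W (d x u); set q := W (d t u); set r := W (d z u); set s := W (d y u).
(* Cauchy-Schwarz for three increments: the slack is the sum of the squares of their pairwise
   differences. *)
have := sqr_ge0 ((p - q) - (q - r)); have := sqr_ge0 ((p - q) - (r - s)).
by have := sqr_ge0 ((q - r) - (r - s)); lra.
Qed.

(** The expansion bounds the mean squared length over edges from above and the contraction bounds
    the one at distance [j.+1] from below; [sphere_energy_le], summed over coordinates, links the
    two. *)
Lemma distortion_lower n (rho : V -> 'rV[R]_n) j : injective rho -> (j < 3)%N ->
  (1 - W 1) * j.+1%:R ^+ 2 <= (1 - W j.+1) * distortion e rho ^+ 2.
Proof.
move=> rho_inj j3.
have [x0 _] := @gdist_attained 0 isT.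
have V_gt0 : 0 < #|V|%:R :> R by rewrite ltr0n; apply/card_gt0P; exists x0.
pose T i := \sum_x \sum_(y | d x y == i) l2norm (rho x - rho y) ^+ 2.
have T_energy i : T i = \sum_l sphere_energy i (fun x => rho x 0 l).
  rewrite /T [RHS]exchange_big; apply: eq_bigr => x _ /=.
  rewrite [RHS]exchange_big; apply: eq_bigr => y _ /=.
  by rewrite sqr_l2norm; apply: eq_bigr => l _; rewrite !mxE.
have Kp i : (i < 4)%N -> 0 < K i by move=> i4; rewrite sphere_size_gt0.
have T_le : (1 - W 1) * (T j.+1 / K j.+1) <= (1 - W j.+1) * (T 1 / K 1).
  rewrite !T_energy !mulrA !mulr_sumr !mulr_suml; apply: ler_sum => l _.
  exact: sphere_energy_le.
have sum_const i (a : R) : (i < 4)%N ->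
    \sum_x \sum_(y | d x y == i) a = #|V|%:R * (K i * a).
  move=> i4; under eq_bigr => x _.
    rewrite sumr_const -mulr_natl.
    have -> : #|[pred y | d x y == i]|%:R = K i :> R.
      by rewrite -(card_sphere x i4) cardsE.
    over.
  by rewrite sumr_const mulr_natl.
set X := expansion e rho; set Y := contraction e rho.
have T1 : T 1 / K 1 <= #|V|%:R * X ^+ 2.
  rewrite ler_pdivrMr ?Kp // mulrAC -mulrA -sum_const //.
  apply: ler_sum => x _; apply: ler_sum => y /eqP d1.
  rewrite ler_pXn2r ?nnegrE ?l2norm_ge0 ?bigmax_ge_id //.
  by have := l2norm_le_expansion rho e_conn x y; rewrite d1 mulr1.
have Tj : #|V|%:R * j.+1%:R ^+ 2 <= Y ^+ 2 * (T j.+1 / K j.+1).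
  rewrite mulrA ler_pdivlMr ?Kp // mulrAC -mulrA -sum_const //.
  rewrite mulr_sumr; apply: ler_sum => x _; rewrite mulr_sumr.
  apply: ler_sum => y /eqP dj; rewrite -exprMn ler_pXn2r ?nnegrE ?mulr_ge0 //.
  - by rewrite -dj; apply: gdist_le_contraction.
  - exact: bigmax_ge_id.
  - exact: l2norm_ge0.
rewrite -(ler_pM2l V_gt0).
have W1 : 0 <= 1 - W 1 by rewrite subr_ge0 ltW // cos_th1_lt1.
have Wj : 0 <= 1 - W j.+1 by rewrite subr_ge0 ltW // cos_th1_lt1.
(* The three bounds are scaled so that they chain: from distance [j.+1] to [T j.+1], then to [T 1],
   then to the expansion. *)
have A1 := ler_wpM2l W1 Tj.
have A2 := ler_wpM2l (sqr_ge0 Y) T_le.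
have A3 := ler_wpM2l (mulr_ge0 (sqr_ge0 Y) Wj) T1.
rewrite /distortion -/X -/Y exprMn; lra.
Qed.

(** Up to the factor [N (th i1)], the projection of the unit vector at [x] onto the
    [th i1]-eigenspace; coordinates indexed by vertices avoid choosing a basis there. *)
Definition eigenspace_embedding (x : V) : 'rV[R]_#|V| :=
  \row_i W (d x (enum_val i)).
Local Notation rho := eigenspace_embedding.

Lemma l2norm_eigenspace_embedding x y :
  l2norm (rho x - rho y) = Num.sqrt (2 * N (th i1) * (1 - W (d x y))).
Proof.
congr Num.sqrt; rewrite -gdist_embedding // [RHS](reindex (@enum_val V predT)).
  by apply: eq_bigr => i _; rewrite !mxE.
exact/onW_bij/enum_val_bij.
Qed.

Lemma eigenspace_embedding_inj : injective rho.
Proof.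
move=> x y /eqP xy; apply/eqP; apply: contraTT xy => xy.
rewrite -subr_eq0; apply/eqP => rho0; have := l2norm_eigenspace_embedding x y.
rewrite rho0 /l2norm big1 ?sqrtr0 => [/esym/eqP|i _]; last by rewrite mxE expr0n.
rewrite sqrtr_eq0; apply/negP; rewrite -ltNge !mulr_gt0 ?cos_dot_gt0 //.
move: xy; rewrite -(gdist_eq0 e_conn) subr_gt0; have := gdist_lt4 x y.
by case: (d x y) => // j j4 _; rewrite cos_th1_lt1.
Qed.

Lemma distortion_eigenspace_embedding (M : R) :
  (forall j, (j < 3)%N -> j.+1%:R ^+ 2 * (1 - W 1) <= M * (1 - W j.+1)) ->
  distortion e rho ^+ 2 <= M.
Proof.
move=> HM.
have N_gt0 : 0 < 2 * N (th i1) by rewrite mulr_gt0 // cos_dot_gt0.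
have W1 : 0 < 1 - W 1 by rewrite subr_gt0 cos_th1_lt1.
have M_ge0 : 0 <= M.
  by rewrite -(pmulr_lge0 _ W1) (le_trans _ (HM 0 isT)) // expr1n mul1r ltW.
have dP (x y : V) : x != y -> exists2 j, (j < 3)%N & d x y = j.+1.
  rewrite -(gdist_eq0 e_conn); have := gdist_lt4 x y.
  by case: (d x y) => // j j4 _; exists j.
(* The common length of the images of the edges. *)
set s := Num.sqrt (2 * N (th i1) * (1 - W 1)).
have s_gt0 : 0 < s by rewrite sqrtr_gt0 mulr_gt0.
have X_le : expansion e rho <= s.
  apply: bigmax_le => [|[x y] /= xy]; first exact: ltW.
  have d_gt0 : 0 < (d x y)%:R :> R by rewrite ltr0n lt0n gdist_eq0.
  rewrite l2norm_eigenspace_embedding ler_pdivrMr //.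
  rewrite -(@ler_pXn2r _ 2) ?nnegrE ?sqrtr_ge0 ?mulr_ge0 ?(ltW s_gt0) //.
  rewrite exprMn !sqr_sqrtr ?(mulr_ge0 (ltW N_gt0)) ?(ltW W1) //; last first.
    by rewrite subr_ge0 cos_le1 // gdist_lt4.
  rewrite -[leRHS]mulrA ler_pM2l // [leRHS]mulrC.
  by apply: cos_le_sqr; apply: gdist_lt4.
have Y_le : contraction e rho <= Num.sqrt M / s.
  apply: bigmax_le => [|[x y] /= xy]; first by rewrite divr_ge0 ?sqrtr_ge0.
  have [j j3 d_xy] := dP x y xy.
  have Wj : 0 < 1 - W j.+1 by rewrite subr_gt0 cos_th1_lt1.
  rewrite l2norm_eigenspace_embedding d_xy ler_pdivrMr; last first.
    by rewrite sqrtr_gt0 mulr_gt0.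
  rewrite mulrAC ler_pdivlMr //.
  rewrite -(@ler_pXn2r _ 2) ?nnegrE ?mulr_ge0 ?sqrtr_ge0 ?(ltW s_gt0) //.
  rewrite !exprMn !sqr_sqrtr ?(mulr_ge0 (ltW N_gt0)) ?(ltW W1) ?(ltW Wj) //.
  by rewrite mulrCA [leRHS]mulrCA ler_pM2l // HM.
have le_M : distortion e rho <= Num.sqrt M.
  have -> : Num.sqrt M = s * (Num.sqrt M / s) by rewrite mulrC divfK // gt_eqF.
  by apply: ler_pM; rewrite ?bigmax_ge_id.
rewrite -[leRHS]sqr_sqrtr // ler_pXn2r ?nnegrE ?sqrtr_ge0 //.
exact: distortion_ge0.
Qed.

Lemma c2_eigenspace_embedding :
  is_c2 e (distortion e rho) /\
  distortion e rho ^+ 2 = Num.max (4 * ((1 - W 1) / (1 - W 2)))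
                                  (9 * ((1 - W 1) / (1 - W 3))).
Proof.
set M := Num.max _ _.
have Wp j : (j < 3)%N -> 0 < 1 - W j.+1 by move=> j3; rewrite subr_gt0 cos_th1_lt1.
have lower n (f : V -> 'rV[R]_n) : injective f -> M <= distortion e f ^+ 2.
  move=> f_inj; rewrite /M ge_max; apply/andP; split.
    rewrite mulrA ler_pdivrMr ?Wp // mulrC [leRHS]mulrC.
    have -> : 4 = 2%:R ^+ 2 :> R by ring.
    exact: distortion_lower.
  rewrite mulrA ler_pdivrMr ?Wp // mulrC [leRHS]mulrC.
  have -> : 9 = 3%:R ^+ 2 :> R by ring.
  exact: distortion_lower.
have upper : distortion e rho ^+ 2 <= M.
  apply: distortion_eigenspace_embedding => j j3.
  have M2 : 2%:R ^+ 2 * (1 - W 1) <= M * (1 - W 2).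
    rewrite -ler_pdivrMr ?Wp // /M le_max; apply/orP; left.
    have -> : 2%:R ^+ 2 = 4 :> R by ring.
    by rewrite mulrA.
  have M3 : 3%:R ^+ 2 * (1 - W 1) <= M * (1 - W 3).
    rewrite -ler_pdivrMr ?Wp // /M le_max; apply/orP; right.
    have -> : 3%:R ^+ 2 = 9 :> R by ring.
    by rewrite mulrA.
  case: j j3 => [|[|[|]]] // _.
  (* Distance 1 only asks for [1 <= M], which follows from the bound at distance 2 because
     [1 - W 2 <= 4 * (1 - W 1)]. *)
  have W2 := cos_le_sqr (i := 2) isT; have Wp1 := Wp 0 isT.
  have M_gt0 : 0 < M.
    by rewrite -(pmulr_lgt0 _ (Wp 1 isT)) (lt_le_trans _ M2) // mulr_gt0 ?exprn_gt0.
  have := ler_wpM2l (ltW M_gt0) W2; lra.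
have M_ge0 : 0 <= M by rewrite (le_trans (sqr_ge0 _) upper).
have E : distortion e rho ^+ 2 = M.
  by apply: le_anti; rewrite upper lower //; apply: eigenspace_embedding_inj.
split=> //; split; first by exists #|V|, rho; split=> //; apply: eigenspace_embedding_inj.
move=> D [n [f [f_inj <-]]].
rewrite -(@ler_pXn2r _ 2) ?nnegrE ?distortion_ge0 // E; exact: lower.
Qed.

(** With [c 3 = k] the last row reads [k * W 2 = th i1 * W 3], so [W 2 = W 1 * W 3] with [W 1] in
    [0, 1). *)
Lemma antipodal_cos_le r : antipodal_cover e r ->
  4 * (1 - W 3) <= 9 * (1 - W 2).
Proof.
case=> _ [P [_ _ fibres]].
have [x [y d_xy]] := @gdist_attained 3 isT.
(* A neighbour of [y] also at distance 3 from [x] would share the block of [y], hence be at distance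
   3 from [y]. *)
have c3 : c 3 = k.
  have := card_closer x y; rewrite d_xy => <-; rewrite -(card_nbrs y).
  apply: eq_card => z; rewrite !inE andb_idr // => eyz.
  have zx := gdist_lt4 x z.
  have le_dz : (3 <= (d x z).+1)%N.
    by rewrite -d_xy gdist_step // (proj1 e_simple).
  move: zx le_dz; rewrite !ltnS leq_eqVlt => /orP[/eqP d_xz _|]; last first.
    by case: (d x z) => [|[|[|]]].
  move: (fibres x y) (fibres x z); rewrite d_xy d_xz diam3 eqxx.
  move=> /esym/andP[_ /eqP yx] /esym/andP[_ /eqP zx].
  have := fibres y z; rewrite -yx zx eqxx andbT diam3.
  have [yz|_] := eqVneq y z; first by move: eyz; rewrite yz (proj2 e_simple).
  by move: eyz; rewrite -gdist_adj // => /eqP->.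
have W3 : kR * W 2 = th i1 * W 3 by rewrite -(th_eig i1) c3; ring.
have th1 : 0 <= th i1.
  exact: (th1_ge0 k_gt0 B1_gt0 B2_gt0 C2_gt0 C3_gt0 th0 th_eig th_decr cos_th_le1).
have W2 : W 2 = W 1 * W 3.
  apply: (mulfI (lt0r_neq0 k_gt0)).
  by rewrite W3 (mulrA kR) cos_seq1.
have W1 : 0 <= W 1.
  by rewrite -(pmulr_rge0 _ k_gt0) cos_seq1.
have W1_lt := cos_th1_lt1 (i := 0) isT.
have W3_lt := cos_th1_lt1 (i := 2) isT.
have W3_ge := cos_geN1 (th_eig i1) (i := 3) isT.
rewrite W2; move: (W 1) (W 3) W1 W1_lt W3_lt W3_ge => p q p0 p1 q1 q1'.
(* For negative [q], the bound [-1 <= q] gives [4 * (1 - q) <= 8], while [9 * (1 - p * q)] is at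
   least 9. *)
have [q0|q0] := lerP 0 q.
  by have : p * q <= q; [rewrite ler_piMl // ltW | lra].
by have : p * q <= 0; [rewrite mulr_ge0_le0 // ltW | lra].
Qed.

(** * Closed forms in the intersection numbers *)

Lemma cos_ratio2E : 4 * ((1 - W 1) / (1 - W 2)) =
  4 * B1 / (th 0 + th i1 - a_ R k b c 1).
Proof.
have th1k : kR - th i1 != 0.
  by rewrite subr_eq0 gt_eqF // -th0 th_decr.
rewrite th0 /a_ intersection_c1; set D := _ + _ - _.
(* The factor [kR - th i1] cancels against [1 - W 1]; that [D] is nonzero is read off from
   [W 2 < 1]. *)
have W2 : 1 - W 2 = (kR - th i1) * D / (kR * B1).
  by rewrite /cos_seq /= /D; field; rewrite !gt_eqF.
have D0 : D != 0.
  have : 1 - W 2 != 0 by rewrite subr_eq0 gt_eqF // cos_th1_lt1.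
  by rewrite W2; apply: contraNneq => ->; rewrite mulr0 mul0r.
by rewrite W2 /cos_seq /=; field; rewrite D0 th1k !gt_eqF.
Qed.

Lemma cos_ratio3E : 9 * ((1 - W 1) / (1 - W 3)) =
  9 * B1 * B2 / ((th 0 + th i1 - a_ R k b c 1) * (th 0 + th i1 - a_ R k b c 2)
    - th 0 * th i1 - B1 * C2 - th 0).
Proof.
have th1k : kR - th i1 != 0.
  by rewrite subr_eq0 gt_eqF // -th0 th_decr.
rewrite th0 /a_ intersection_c1; set D := _ - _ - _ - _.
have W3 : 1 - W 3 = (kR - th i1) * D / (kR * B1 * B2).
  by rewrite /cos_seq /= /D; field; rewrite !gt_eqF.
have D0 : D != 0.
  have : 1 - W 3 != 0 by rewrite subr_eq0 gt_eqF // cos_th1_lt1.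
  by rewrite W3; apply: contraNneq => ->; rewrite mulr0 mul0r.
by rewrite W3 /cos_seq /=; field; rewrite D0 th1k !gt_eqF.
Qed.

End Spectrum.

Lemma cosine_sequenceE t v i : cosine_sequence 3 k b c t v -> (i < 4)%N ->
  v i = w t i.
Proof.
case=> v0 v1 v_rec.
have v2 : v 2 = w t 2.
  apply: (mulfI (lt0r_neq0 B1_gt0)); have := v_rec 1%N isT.
  have := @cos_seq2 R kR B1 B2 C2 k_gt0 B1_gt0 t.
  have -> : w t 1 = v 1 by rewrite v1.
  by rewrite /a_ intersection_c1 v0 /=; lra.
have v3 : v 3 = w t 3.
  apply: (mulfI (lt0r_neq0 B2_gt0)); have := v_rec 2%N isT.
  have := @cos_seq3 R kR B1 B2 C2 k_gt0 B1_gt0 B2_gt0 t.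
  have -> : w t 1 = v 1 by rewrite v1.
  by rewrite /a_ -v2 /=; lra.
by case: i => [|[|[|[|]]]] // _; rewrite v0 cos_seq0.
Qed.

End Diameter3.

Theorem theorem4p3 (R : realType) (V : finType) (e : rel V)
    (k : nat) (b c : nat -> nat)
    (G_dr : distance_regular e 3 k b c)
    (theta0 theta1 theta2 theta3 : R)
    (theta_decr : [/\ theta0 > theta1, theta1 > theta2 & theta2 > theta3])
    (theta_spec : forall t : R, eigenvalue (adjacency_mx R e) t <->
       t \in [:: theta0; theta1; theta2; theta3])
    (w : nat -> R) (w_cos : cosine_sequence 3 k b c theta1 w) :
  let a1 : R := a_ R k b c 1 in
  let a2 : R := a_ R k b c 2 in
  let b1 : R := (b 1%N)%:R in
  let b2 : R := (b 2%N)%:R in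
  let c2 : R := (c 2%N)%:R in
  let cos2 : R := 4 * ((1 - w 1%N) / (1 - w 2%N)) in
  let cos3 : R := 9 * ((1 - w 1%N) / (1 - w 3%N)) in
  let num2 : R := 4 * b1 / (theta0 + theta1 - a1) in
  let num3 : R := 9 * b1 * b2 /
    ((theta0 + theta1 - a1) * (theta0 + theta1 - a2)
       - theta0 * theta1 - b1 * c2 - theta0) in
  exists C : R,
    [/\ is_c2 e C,
        C ^+ 2 = Num.max cos2 cos3 /\ Num.max cos2 cos3 = Num.max num2 num3
      & forall r : nat, antipodal_cover e r ->
          C ^+ 2 = cos3 /\ cos3 = num3].
Proof.
move=> a1 a2 b1 b2 c2 cos2 cos3 num2 num3.
pose s := [:: theta0; theta1; theta2; theta3].
pose th (i : 'I_4) := nth 0 s i.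
have [th01 th12 th23] := theta_decr.
have th_eig i : cos_eigen k%:R (b 1)%:R (b 2)%:R (c 2)%:R (c 3)%:R (th i).
  by apply/(eigenvalue_cos_eigen G_dr)/theta_spec/mem_nth.
(* No eigenvalue exceeds the valency, and the valency is itself an eigenvalue, hence at most
   [theta0]. *)
have th0 : th 0 = k%:R.
  apply: le_anti; rewrite (eigenvalue_le_valency G_dr) //=.
  have /theta_spec := eigenvalue_valency R G_dr.
  by rewrite !inE /th /= => /or4P[] /eqP->; lra.
have th_decr : {homo th : i j / (i < j)%N >-> j < i}.
  by case=> [[|[|[|[|]]]] ?] // [[|[|[|[|]]]] ?] // _; rewrite /th /=; lra.
have wE i : (i < 4)%N -> w i = _ := cosine_sequenceE G_dr w_cos.
have [C_c2 C_sq] := c2_eigenspace_embedding G_dr th0 th_eig th_decr.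
have E2 : cos2 = num2.
  rewrite /cos2 !wE //; exact: (cos_ratio2E G_dr th0 th_eig th_decr).
have E3 : cos3 = num3.
  rewrite /cos3 !wE //; exact: (cos_ratio3E G_dr th0 th_eig th_decr).
have Csq : distortion e (eigenspace_embedding e k b c th) ^+ 2 = Num.max cos2 cos3.
  by rewrite C_sq /cos2 /cos3 !wE.
exists (distortion e (eigenspace_embedding e k b c th)); split=> //.
  by rewrite {1}Csq E2 E3.
move=> r G_cover; split=> //; rewrite Csq; apply/max_idPr.
have := antipodal_cos_le G_dr th0 th_eig th_decr G_cover.
have w2_lt := cos_th1_lt1 G_dr th0 th_eig th_decr (i := 1) isT.
have w3_lt := cos_th1_lt1 G_dr th0 th_eig th_decr (i := 2) isT.
have w1_lt := cos_th1_lt1 G_dr th0 th_eig th_decr (i := 0) isT.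
rewrite /cos2 /cos3 !wE // => le23.
rewrite !mulrA ler_pdivrMr ?subr_gt0 // mulrAC ler_pdivlMr ?subr_gt0 //.
by rewrite mulrAC [leRHS]mulrAC ler_pM2r ?subr_gt0.
Qed.
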